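(* Let $\mathbb{X}$ be a real ordered vector space, $x,y\in\mathbb{X}$ with $x\le y$, let $\mathbb{Y}$ be a Dedekind complete vector lattice, and let $f:[x,y]\to\mathbb{Y}$ be a function of bounded variation with variation function $\mathcal{V}_f$. Then: (1) $\mathcal{V}_f$ is monotonically increasing and $\mathcal{V}_f(x)=0$. (2) $\mathcal{V}_f(z)\ge |f(z)-f(x)|$ for all $z\in[x,y]$. (3) $\mathcal{V}_h=h$ for every monotonically increasing function $h:[x,y]\to\mathbb{Y}$ such that $h(x)=0$. For $\mathcal{V}_f^{\pm}(z)=\frac12\big(\mathcal{V}_f(z)\pm(f(z)-f(x))\big)$, $z\in[x,y]$, moreover: (4) $\mathcal{V}_f^{\pm}(z)\ge 0$ for all $z\in[x,y]$. (5) $\mathcal{V}_f^{+}$ and $\mathcal{V}_f^{-}$ are monotonically increasing. (6) $\mathcal{V}_f=\mathcal{V}_f^{+}+\mathcal{V}_f^{-}$. (7) $f=f(x)+\mathcal{V}_f^{+}-\mathcal{V}_f^{-}$.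
   Context: A real ordered vector space is a real vector space $\mathbb{X}$ with a cone $\mathbb{X}^+$ (non-empty, closed under addition and under multiplication by non-negative reals); $u\le v$ means $v-u\in\mathbb{X}^+$, and $u<v$ means $u\le v$ and $u\neq v$. For $a\le b$, $[a,b]=\{w\in\mathbb{X}: a\le w\le b\}$. A partition $\mathcal{P}$ of $[a,b]$ is a finite chain $a=x_0<x_1<\cdots<x_{n_{\mathcal P}}=b$ of points of $[a,b]$ (if $a=b$ this is the single point and the sum below is $0$). In a vector lattice $\mathbb{Y}$, $|u|=u\vee(-u)$. $\mathbb{Y}$ is Dedekind complete if every non-empty subset that is bounded above has a supremum in $\mathbb{Y}$. For a function $f$ on $[a,b]$ with values in $\mathbb{Y}$ put $\Sigma_{\mathcal P}[f]=\sum_{i=1}^{n_{\mathcal P}}|f(x_i)-f(x_{i-1})|$. The function $f$ is of bounded variation on $[a,b]$ if $\mathcal{V}(f,a,b)=\sup\{\Sigma_{\mathcal P}[f]:\mathcal P \text{ a partition of }[a,b]\}$ exists in $\mathbb{Y}$. If $\mathbb{Y}$ is a Dedekind complete vector lattice and $f$ is of bounded variation on $[x,y]$, then $f$ is of bounded variation on $[x,z]$ for every $z\in[x,y]$, and the variation function $\mathcal{V}_f:[x,y]\to\mathbb{Y}$ is defined by $\mathcal{V}_f(z)=\mathcal{V}(f,x,z)$. A function $h:[x,y]\to\mathbb{Y}$ is monotonically increasing if $z_1\le z_2$ in $[x,y]$ implies $h(z_1)\le h(z_2)$. *)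

(* Defs.v *)
From HB Require Import structures.
From mathcomp Require Import all_boot all_order all_algebra.
From mathcomp Require Import all_classical all_reals.

Set Implicit Arguments.
Unset Strict Implicit.
Unset Printing Implicit Defensive.

Import Order.TTheory GRing.Theory Num.Theory.

Local Open Scope classical_set_scope.
Local Open Scope ring_scope.

(* A cone K need not satisfy K `&` (- K) = [set 0], so the relation it induces
   is in general only a preorder.  This is why an ordered vector space is given
   by the set K and not by an instance of the MathComp order hierarchy, in which
   moreover x < y on a preorder means x <= y and not y <= x. *)
Definition is_cone (R : realType) (X : lmodType R) (K : set X) : Prop :=
  [/\ K !=set0,
      forall u v, K u -> K v -> K (u + v) &
      forall (a : R) u, 0 <= a -> K u -> K (a *: u)].

Definition cone_le (R : realType) (X : lmodType R) (K : set X) (u v : X) : Prop :=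
  K (v - u).

Definition cone_lt (R : realType) (X : lmodType R) (K : set X) (u v : X) : Prop :=
  cone_le K u v /\ u <> v.

Definition cone_itv (R : realType) (X : lmodType R) (K : set X) (a b : X) : set X :=
  [set w | cone_le K a w /\ cone_le K w b].

HB.mixin Record Lmodule_POrder_isOrdered (R : realType) V
    of GRing.Lmodule R V & Order.POrder ring_display V := {
  olmod_leD2r : forall w u v : V, u <= v -> u + w <= v + w;
  olmod_leZ2l : forall (a : R) (u v : V), 0 <= a -> u <= v -> a *: u <= a *: v
}.

#[short(type="orderedLmodType")]
HB.structure Definition OrderedLmodule (R : realType) :=
  { V of GRing.Lmodule R V & Order.POrder ring_display V
       & Lmodule_POrder_isOrdered R V }.

(* Being a lattice is a predicate: HB refuses a join of Order.Lattice with
   GRing.Lmodule declared after Num.RealDomain. *)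
Definition is_vector_lattice (R : realType) (Y : orderedLmodType R) : Prop :=
  forall u v : Y, supremums [set u; v] !=set0 /\ infimums [set u; v] !=set0.

(* The join of u and - u; the default value 0 plays no role in a vector
   lattice. *)
Definition vl_abs (R : realType) (Y : orderedLmodType R) (u : Y) : Y :=
  supremum 0 [set u; - u].

Definition dedekind_complete (R : realType) (Y : orderedLmodType R) : Prop :=
  forall A : set Y, A !=set0 -> has_ubound A -> supremums A !=set0.

(* The chain p 0 < p 1 < ... < p n; the values p i for i > n are irrelevant.
   When the cone is pointed and a = b, the chain conditions force n = 0. *)
Definition is_partition (R : realType) (X : lmodType R) (K : set X) (a b : X)
    (n : nat) (p : nat -> X) : Prop :=
  [/\ p 0%N = a, p n = b,
      forall i, (i <= n)%N -> cone_itv K a b (p i) &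
      forall i, (i < n)%N -> cone_lt K (p i) (p i.+1)].

Section BoundedVariation.
Variables (R : realType) (X : lmodType R) (K : set X).
Variable Y : orderedLmodType R.

(* Functions on an order interval are represented by total functions X -> Y;
   every notion below only looks at their values on that interval. *)
Implicit Type f : X -> Y.

Definition partition_sum f (n : nat) (p : nat -> X) : Y :=
  \sum_(i < n) vl_abs (f (p i.+1) - f (p i)).

Definition partition_sums f (a b : X) : set Y :=
  [set s | exists n p, is_partition K a b n p /\ s = partition_sum f n p].

Definition bounded_variation f (a b : X) : Prop :=
  supremums (partition_sums f a b) !=set0.

(* The default value 0 is only taken if the supremum does not exist, i.e. if
   f is not of bounded variation on [a, b]. *)
Definition variation f (a b : X) : Y := supremum 0 (partition_sums f a b).

Definition variation_fun f (x z : X) : Y := variation f x z.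

Definition pos_variation_fun f (x z : X) : Y :=
  2^-1 *: (variation_fun f x z + (f z - f x)).

Definition neg_variation_fun f (x z : X) : Y :=
  2^-1 *: (variation_fun f x z - (f z - f x)).

Definition increasing_on (x y : X) f : Prop :=
  forall z1 z2, cone_itv K x y z1 -> cone_itv K x y z2 ->
    cone_le K z1 z2 -> f z1 <= f z2.

End BoundedVariation.

(* Main.v *)
Require Import Defs.
From HB Require Import structures.
From mathcomp Require Import all_boot all_order all_algebra.
From mathcomp Require Import all_classical all_reals.

(** Everything rests on one inequality: the variation is superadditive,
    V(a,b) + V(b,c) <= V(a,c) whenever a <= b <= c.  A partition of [a,b]
    followed by a partition of [b,c] is a partition of [a,c], the two sums add
    up, and one takes suprema on the left ([variation_superadditive]).  Together
    with |f b - f a| <= V(a,b), which comes from the partition with at most one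
    step, it gives for x <= z1 <= z2 <= y

      V_f(z1) + |f z2 - f z1| <= V_f(z2)          ([variation_fun_increment]).

    As |u| dominates 0, u and - u, this shows that V_f and V_f +- f are
    increasing, hence so are both halves of the decomposition; z1 = x gives
    their signs, and the remaining identities are linear algebra.

    That V_f(x) = 0 needs an argument, because the cone need not be pointed: the
    interval [x,x] may have points other than x, and its partitions may be
    nontrivial loops at x.  Superadditivity on x <= x <= x reads
    V_f(x) + V_f(x) <= V_f(x), so V_f(x) <= 0.

    For increasing h every absolute value in a partition sum is the increment
    itself, so all partition sums over [x,z] telescope to h z - h x. *)

Set Implicit Arguments.
Unset Strict Implicit.
Unset Printing Implicit Defensive.

Import Order.TTheory GRing.Theory Num.Theory.

Local Open Scope classical_set_scope.
Local Open Scope ring_scope.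

(** * Order and absolute value in an ordered vector space *)

Section OrderedLmodule.
Context {R : realType} {Y : orderedLmodType R}.
Implicit Types (u v w : Y) (A B : set Y).

Lemma olmod_leD u1 u2 v1 v2 : u1 <= v1 -> u2 <= v2 -> u1 + u2 <= v1 + v2.
Proof.
move=> le1 le2; apply: (le_trans (olmod_leD2r u2 _ _ le1)).
by rewrite [v1 + u2]addrC [v1 + v2]addrC; exact: olmod_leD2r.
Qed.

Lemma olmod_leBrDr u v w : (u <= v - w) <-> (u + w <= v).
Proof.
split=> [/(olmod_leD2r w _ _)|/(olmod_leD2r (- w) _ _)]; first by rewrite subrK.
by rewrite addrK.
Qed.

Lemma olmod_subr_ge0 u v : (0 <= v - u) <-> (u <= v).
Proof. by rewrite olmod_leBrDr add0r. Qed.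

Lemma olmod_le_oppl u v : - u <= v -> - v <= u.
Proof.
move=> /olmod_subr_ge0; rewrite opprK addrC -{1}(opprK v).
by move=> /olmod_subr_ge0.
Qed.

Lemma olmod_scale_ge0 (a : R) u : 0 <= a -> 0 <= u -> 0 <= a *: u.
Proof. by move=> a0 /(olmod_leZ2l _ _ _ a0); rewrite scaler0. Qed.

Lemma supremums_supremum u A :
  A !=set0 -> supremums A !=set0 -> supremums A (supremum u A).
Proof.
move=> /set0P/negbTE A0 [s sA]; rewrite /supremum A0.
by case: xgetP => [_ _ //|/(_ s)].
Qed.

(** Translations are order isomorphisms, so each of the two suprema may be taken
    with the other summand moved to the right-hand side. *)
Lemma supremums_add_le A B a b w : supremums A a -> supremums B b ->
  (forall s t, A s -> B t -> s + t <= w) -> a + b <= w.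
Proof.
move=> [_ leastA] [_ leastB] le_w.
have le_b s : A s -> b <= w - s.
  by move=> As; apply: leastB => t Bt; apply/olmod_leBrDr; rewrite addrC le_w.
apply/olmod_leBrDr; apply: leastA => s As; apply/olmod_leBrDr.
by rewrite addrC; apply/olmod_leBrDr/le_b.
Qed.

Lemma olmod_leD_subl u1 u2 v1 v2 w :
  u1 - u2 <= v2 - v1 -> v1 + (u1 - w) <= v2 + (u2 - w).
Proof.
move=> le_uv; apply/olmod_subr_ge0; rewrite opprD addrACA opprB subrKA.
by rewrite -(opprB u1); apply/olmod_subr_ge0.
Qed.

Lemma vl_abs_pos u : 0 <= u -> vl_abs u = u.
Proof.
move=> u_ge0; have Nu_le0 : - u <= 0 by apply: olmod_le_oppl; rewrite oppr0.
have supu : supremums [set u; - u] u.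
  split=> [_ [->|->]|v]; first exact: lexx; first exact: le_trans u_ge0.
  by apply; left.
apply: (is_subset1_supremums _ supu); apply: supremums_supremum.
  by exists u; left.
by exists u.
Qed.

Lemma vl_abs_le (hYl : is_vector_lattice Y) u v :
  vl_abs u <= v -> u <= v /\ - u <= v.
Proof.
move=> le_uv; have [ub _] : supremums [set u; - u] (vl_abs u).
  by apply: supremums_supremum; [exists u; left | exact: (hYl _ _).1].
by split; apply: le_trans le_uv; apply: ub; [left | right].
Qed.

Lemma vl_abs_ge0 (hYl : is_vector_lattice Y) u : 0 <= vl_abs u.
Proof.
have [le_u le_Nu] := vl_abs_le hYl (lexx (vl_abs u)).
have ge0 : 0 <= vl_abs u + vl_abs u by rewrite -(subrr u); exact: olmod_leD.
have half_ge0 : 0 <= 2^-1 :> R by rewrite invr_ge0.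
move: (olmod_scale_ge0 half_ge0 ge0).
by rewrite -mulr2n -scaler_nat scalerA mulVf ?scale1r // pnatr_eq0.
Qed.

Lemma halfD_halfB u v : 2^-1 *: (u + v) + 2^-1 *: (u - v) = u.
Proof.
rewrite -scalerDr addrACA subrr addr0 -mulr2n -scaler_nat scalerA.
by rewrite mulVf ?scale1r // pnatr_eq0.
Qed.

Lemma halfD_sub_halfB u v : 2^-1 *: (u + v) - 2^-1 *: (u - v) = v.
Proof.
rewrite -scalerBr opprB [u + v]addrC addrACA subrr addr0.
by rewrite -mulr2n -scaler_nat scalerA mulVf ?scale1r // pnatr_eq0.
Qed.

End OrderedLmodule.

(** * Partitions of order intervals *)

Section Partitions.
Context {R : realType} {X : lmodType R} {K : set X} (hK : is_cone K).
Context {Y : orderedLmodType R}.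
Implicit Types (a b c : X) (f h : X -> Y).

Lemma cone_le_refl a : cone_le K a a.
Proof.
case: hK => -[u Ku] _ KZ.
by rewrite /cone_le subrr -(scale0r u); apply: KZ.
Qed.

Lemma cone_le_trans b a c : cone_le K a b -> cone_le K b c -> cone_le K a c.
Proof.
case: hK => _ KD _ Kab Kbc.
by rewrite /cone_le -(subrKA b); apply: KD.
Qed.

(** The junction b occurs once, as the last point of the first chain: repeating
    it would break strictness. *)
Lemma is_partition_cat a b c n m p q :
  cone_le K a b -> cone_le K b c ->
  is_partition K a b n p -> is_partition K b c m q ->
  is_partition K a c (n + m) (fun i => if (i <= n)%N then p i else q (i - n)%N).
Proof.
move=> le_ab le_bc [p0 pn p_itv p_lt] [q0 qm q_itv q_lt]; split=> //.
- case: leqP; last by rewrite addKn.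
  rewrite -{2}(addn0 n) leq_add2l leqn0 => /eqP m0.
  by rewrite m0 addn0 pn -q0 -qm m0.
- move=> i le_i; case: leqP => [/p_itv[le_ai le_ib]|lt_ni].
    by split=> //; apply: cone_le_trans le_bc.
  have [|le_bi le_ic] := q_itv (i - n)%N; first by rewrite leq_subLR.
  by split=> //; apply: cone_le_trans le_bi.
- move=> i lt_i; case: (ltngtP i n) => [lt_in|lt_ni|eq_in].
  + exact: p_lt.
  + by rewrite subSn 1?ltnW//; apply: q_lt; rewrite ltn_subLR // ltnW.
  + (* the step that leaves p n = b = q 0 is the first step of q *)
    rewrite eq_in subSnn pn -q0; apply: q_lt.
    by move: lt_i; rewrite eq_in -{1}(addn0 n) ltn_add2l.
Qed.

Lemma partition_sum_cat f n m p q : p n = q 0%N ->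
  partition_sum f (n + m) (fun i => if (i <= n)%N then p i else q (i - n)%N)
    = partition_sum f n p + partition_sum f m q.
Proof.
move=> pn; rewrite /partition_sum big_split_ord /=; congr (_ + _).
  by apply: eq_bigr => i _; rewrite (ltnW (ltn_ord i)) ltn_ord.
apply: eq_bigr => i _; rewrite -addnS !addKn.
have le_nDn k : (n + k <= n)%N = (k == 0%N).
  by rewrite -{2}(addn0 n) leq_add2l leqn0.
by rewrite !le_nDn /=; case: (val i =P 0%N) => // ->; rewrite addn0 pn.
Qed.

Lemma partition_sums_add f a b c s t :
  cone_le K a b -> cone_le K b c ->
  partition_sums K f a b s -> partition_sums K f b c t ->
  partition_sums K f a c (s + t).
Proof.
move=> le_ab le_bc [n [p [p_part ->]]] [m [q [q_part ->]]].
exists (n + m)%N, (fun i => if (i <= n)%N then p i else q (i - n)%N).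
split; first exact: is_partition_cat p_part q_part.
case: p_part q_part => _ pn _ _ [q0 _ _ _].
by rewrite partition_sum_cat // pn q0.
Qed.

(** The chain condition is strict, so for a = b the witness is the partition
    without steps, whose sum 0 is still |f b - f a|. *)
Lemma partition_sums_increment f a b :
  cone_le K a b -> partition_sums K f a b (vl_abs (f b - f a)).
Proof.
move=> le_ab; have le_aa := cone_le_refl a; have le_bb := cone_le_refl b.
have [<-|neq_ab] := pselect (a = b).
  exists 0%N, (fun=> a); split; last first.
    by rewrite /partition_sum big_ord0 subrr vl_abs_pos.
  by split.
exists 1%N, (fun i => if i is 0 then a else b); split.
  by split=> // -[|i].
by rewrite /partition_sum big_ord_recl big_ord0 addr0.
Qed.

Lemma partition_sums_neq0 f a b :
  cone_le K a b -> partition_sums K f a b !=set0.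
Proof. by move=> le_ab; eexists; exact: partition_sums_increment. Qed.

Lemma variation_supremums f a b : cone_le K a b -> bounded_variation K f a b ->
  supremums (partition_sums K f a b) (variation K f a b).
Proof.
by move=> le_ab; apply: supremums_supremum; exact: partition_sums_neq0.
Qed.

(** Along a chain the increments of an increasing function are nonnegative, so
    the absolute values disappear and the sum telescopes. *)
Lemma partition_sums_increasing h a b :
  cone_le K a b -> increasing_on K a b h ->
  partition_sums K h a b = [set h b - h a].
Proof.
move=> le_ab h_incr; apply/seteqP; split=> [_ [n [p [p_part ->]]]|_ ->].
  case: p_part => p0 pn p_itv p_lt.
  rewrite /partition_sum /= -pn -p0 -(telescope_sumr (h \o p)) // big_mkord.
  apply: eq_bigr => i _; apply/vl_abs_pos/olmod_subr_ge0.
  have lt_in := ltn_ord i.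
  by apply: h_incr; [exact/p_itv/ltnW | exact: p_itv | case: (p_lt i)].
have le_aa := cone_le_refl a; have le_bb := cone_le_refl b.
rewrite -(vl_abs_pos (u := h b - h a)); first exact: partition_sums_increment.
exact/olmod_subr_ge0/h_incr.
Qed.

End Partitions.

(** * The variation function *)

Section Variation.
Context {R : realType} {X : lmodType R} {K : set X} (hK : is_cone K).
Context {Y : orderedLmodType R}.
Context (hYl : is_vector_lattice Y) (hYd : dedekind_complete Y).
Implicit Types (a b c : X) (f h : X -> Y).

(** A partition of a smaller interval [a',b'] of [a,b] completes to one of [a,b]
    by the jumps from a to a' and from b' to b; the sums over [a',b'] are
    thus bounded by V(a,b), and Dedekind completeness gives the supremum. *)
Lemma bounded_variation_sub f a b a' b' :
  cone_le K a a' -> cone_le K a' b' -> cone_le K b' b ->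
  bounded_variation K f a b -> bounded_variation K f a' b'.
Proof.
move=> le_aa' le_a'b' le_b'b [v [ub_v _]].
apply: hYd; first exact: partition_sums_neq0.
exists v => s Ss.
have le_ab' := cone_le_trans hK le_aa' le_a'b'.
have S_aa' := partition_sums_increment hK f le_aa'.
have S_b'b := partition_sums_increment hK f le_b'b.
have S_ab' := partition_sums_add hK le_aa' le_a'b' S_aa' Ss.
apply: le_trans (ub_v _ (partition_sums_add hK le_ab' le_b'b S_ab' S_b'b)).
rewrite -[s in s <= _]add0r -[0 + s]addr0.
by apply: olmod_leD (vl_abs_ge0 hYl _); apply: olmod_leD (vl_abs_ge0 hYl _) _.
Qed.

(** Equality may fail: X need not be totally ordered, so a chain from a to c may
    have points incomparable with b and admit no refinement through b. *)
Lemma variation_superadditive f a b c :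
  cone_le K a b -> cone_le K b c -> bounded_variation K f a c ->
  variation K f a b + variation K f b c <= variation K f a c.
Proof.
move=> le_ab le_bc bv; have le_ac := cone_le_trans hK le_ab le_bc.
have le_aa := cone_le_refl hK a; have le_cc := cone_le_refl hK c.
have bv_ab := bounded_variation_sub le_aa le_ab le_bc bv.
have bv_bc := bounded_variation_sub le_ab le_bc le_cc bv.
apply: supremums_add_le (variation_supremums hK le_ab bv_ab)
  (variation_supremums hK le_bc bv_bc) _ => s t Ss St.
exact/(variation_supremums hK le_ac bv).1/(partition_sums_add hK le_ab le_bc).
Qed.

Lemma variation_ge_increment f a b :
  cone_le K a b -> bounded_variation K f a b ->
  vl_abs (f b - f a) <= variation K f a b.
Proof.
move=> le_ab bv; apply: (variation_supremums hK le_ab bv).1.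
exact: partition_sums_increment.
Qed.

(** For a cone that is not pointed, [a,a] can carry loops with several steps;
    concatenating two of them shows that their sums vanish. *)
Lemma variation_point f a : bounded_variation K f a a -> variation K f a a = 0.
Proof.
move=> bv; have le_aa := cone_le_refl hK a.
apply/le_anti/andP; split.
  have := variation_superadditive le_aa le_aa bv.
  by move/olmod_leBrDr; rewrite subrr.
have := variation_ge_increment le_aa bv.
by rewrite subrr vl_abs_pos.
Qed.

Lemma variation_fun_increment f x y z1 z2 :
  bounded_variation K f x y ->
  cone_itv K x y z1 -> cone_itv K x y z2 -> cone_le K z1 z2 ->
  vl_abs (f z2 - f z1) <= variation_fun K f x z2 - variation_fun K f x z1.
Proof.
move=> bv [le_x1 le_1y] [le_x2 le_2y] le_12.
have le_xx := cone_le_refl hK x.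
have bv_x2 := bounded_variation_sub le_xx le_x2 le_2y bv.
have bv_12 := bounded_variation_sub le_x1 le_12 le_2y bv.
apply: le_trans (variation_ge_increment le_12 bv_12) _.
by apply/olmod_leBrDr; rewrite addrC; exact: variation_superadditive.
Qed.

End Variation.

(** * The Jordan decomposition *)

Theorem theorem4p3 (R : realType) (X : lmodType R) (K : set X)
    (hK : is_cone K) (x y : X) (hxy : cone_le K x y)
    (Y : orderedLmodType R) (hYl : is_vector_lattice Y)
    (hYd : dedekind_complete Y)
    (f : X -> Y) (hf : bounded_variation K f x y) :
  (* 1 *)
  (increasing_on K x y (variation_fun K f x) /\ variation_fun K f x x = 0) /\
  (* 2 *)
  (forall z : X, cone_itv K x y z ->
     vl_abs (f z - f x) <= variation_fun K f x z) /\
  (* 3 *)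
  (forall h : X -> Y, increasing_on K x y h -> h x = 0 ->
     bounded_variation K h x y /\
     forall z : X, cone_itv K x y z -> variation_fun K h x z = h z) /\
  (* 4 *)
  (forall z : X, cone_itv K x y z ->
     0 <= pos_variation_fun K f x z /\ 0 <= neg_variation_fun K f x z) /\
  (* 5 *)
  (increasing_on K x y (pos_variation_fun K f x) /\
   increasing_on K x y (neg_variation_fun K f x)) /\
  (* 6 *)
  (forall z : X, cone_itv K x y z ->
     variation_fun K f x z =
       pos_variation_fun K f x z + neg_variation_fun K f x z) /\
  (* 7 *)
  (forall z : X, cone_itv K x y z ->
     f z = f x + pos_variation_fun K f x z - neg_variation_fun K f x z).
Proof.
have le_xx := cone_le_refl hK x.
have itv_x : cone_itv K x y x by split.
have incr := variation_fun_increment hK hYl hYd hf.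
have V_x : variation_fun K f x x = 0.
  apply: variation_point => //.
  exact: (bounded_variation_sub hK hYl hYd le_xx le_xx hxy hf).
have half_ge0 : 0 <= 2^-1 :> R by rewrite invr_ge0.
have pos_incr : increasing_on K x y (pos_variation_fun K f x).
  move=> z1 z2 h1 h2 le_12; apply: olmod_leZ2l => //.
  apply: olmod_leD_subl; rewrite -opprB.
  exact: (vl_abs_le hYl (incr _ _ h1 h2 le_12)).2.
have neg_incr : increasing_on K x y (neg_variation_fun K f x).
  move=> z1 z2 h1 h2 le_12; apply: olmod_leZ2l => //; rewrite !(opprD (f _)).
  apply: olmod_leD_subl; rewrite opprK addrC.
  exact: (vl_abs_le hYl (incr _ _ h1 h2 le_12)).1.
have pos_x : pos_variation_fun K f x x = 0.
  by rewrite /pos_variation_fun V_x subrr addr0 scaler0.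
have neg_x : neg_variation_fun K f x x = 0.
  by rewrite /neg_variation_fun V_x subrr subr0 scaler0.
split; [split=> // z1 z2 h1 h2 le_12
  | split; [|split; [|split; [|split; [|split]]]]].
- apply/olmod_subr_ge0; apply: le_trans (vl_abs_ge0 hYl _) _.
  exact: incr le_12.
- move=> z hz; have := incr _ _ itv_x hz hz.1.
  by rewrite V_x subr0.
- move=> h h_incr h_x.
  have sums z : cone_itv K x y z -> partition_sums K h x z = [set h z].
    move=> [le_xz le_zy]; rewrite (partition_sums_increasing hK) ?h_x ?subr0 //.
    move=> z1 z2 [? le_1z] [? le_2z]; apply: h_incr; split=> //.
      exact: cone_le_trans le_zy.
    exact: cone_le_trans le_zy.
  split=> [|z hz]; last by rewrite /variation_fun /variation sums // supremum1.
  exists (h y); rewrite sums ?supremums1 //.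
  by split=> //; exact: cone_le_refl.
- move=> z hz; rewrite -{1}pos_x -neg_x.
  by split; [apply: pos_incr | apply: neg_incr] => //; exact: hz.1.
- by split.
- by move=> z _; rewrite halfD_halfB.
- by move=> z _; rewrite -addrA halfD_sub_halfB subrKC.
Qed.
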